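(* Let $t(n,k)$ be the number of paths in $\mathcal{M}_2$ of length $n$ whose end-point has height $k$, and let $\mathit{Total}(z,u)=\sum_{n,k\ge 0}t(n,k)z^nu^k$ be the bivariate generating function of the paths in $\mathcal{M}_2$ with respect to the length and the height of the end-point. Then $$\mathit{Total}(z,u)=\frac{1}{z(r-u)},$$ and for every $k\ge0$ $$[u^k]\,\mathit{Total}(z,u)=\frac{1}{zr^{k+1}}.$$ Moreover, for $n\geq 2$, $k\geq 1$, $$t(n,k)=t(n,k-1)+t(n-1,k-1)-t(n-1,k-2)-t(n-2,k-2),$$ and, setting $t_n:=t(n,0)$, for $n\ge 2$, $$t_n=t_{n-1}+\sum_{k=1}^{n-2}t_kt_{n-1-k}.$$
   Context: Let $U=(1,1)$, $H=(1,0)$ and $D_k=(1,-k)$ for $k\ge 1$ (down steps). $\mathcal{M}_2$ is the set of lattice paths in $\mathbb{N}^2$ (with $\mathbb{N}=\{0,1,2,\dots\}$, so paths never go below the $x$-axis) starting at the origin, made of steps $U$, $H$ and $D_k$ ($k\ge1$), in which every down step and every horizontal step, except possibly when it is the last step of the path, is immediately followed by an up step $U$. The empty path belongs to $\mathcal{M}_2$. The length of a path is its number of steps; the height of a point is its ordinate. By convention $t(n,k)=0$ when $k<0$, and empty sums are $0$. The Laurent series $r$ in $z$ is $$r=\frac{z+1+\sqrt{1-2z-3z^{2}}}{2z(z+1)},$$ where the square root is the power series with constant term $1$. The fraction $1/(r-u)$ is expanded as $\sum_{k\ge0}u^k/r^{k+1}$. *)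

(* Defs.v *)
From HB Require Import structures.
From mathcomp Require Export all_boot all_order all_algebra.
From mathcomp Require Export finmap boolp classical_sets cardinality.

Set Implicit Arguments.
Unset Strict Implicit.
Unset Printing Implicit Defensive.

Import Order.TTheory GRing.Theory Num.Theory.
Local Open Scope ring_scope.

(* [Down j] is the step D_(j+1) = (1, -(j+1)), so that the down steps D_k,
   k >= 1, are in bijection with nat. *)
Inductive step := Up | Horiz | Down of nat.

Definition step_code (s : step) : option (option nat) :=
  match s with Up => None | Horiz => Some None | Down j => Some (Some j) end.
Definition step_decode (c : option (option nat)) : step :=
  match c with None => Up | Some None => Horiz | Some (Some j) => Down j end.
Lemma step_codeK : cancel step_code step_decode. Proof. by case. Qed.

HB.instance Definition _ := Countable.copy step (can_type step_codeK).

Definition rise (s : step) : int :=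
  match s with Up => 1 | Horiz => 0 | Down j => - (j.+1)%:Z end.

Definition height (p : seq step) : int := \sum_(s <- p) rise s.

(* [sorted e p] says that [e] relates any two consecutive items of [p]; here
   [e] is not transitive, and the last step of [p] is unconstrained. *)
Definition M2 : set (seq step) := [set p |
  (forall i : nat, 0 <= height (take i p)) /\
  sorted (fun s s' => (s != Up) ==> (s' == Up)) p].

Definition M2_paths (n : nat) (k : int) : set (seq step) :=
  [set p | [/\ M2 p, size p = n & height p = k]].

(* [fset_set] is the empty set on infinite sets; see [finite_M2_paths]. *)
Definition t (n : nat) (k : int) : nat := #|` fset_set (M2_paths n k)|.

Lemma height_rcons p s : height (rcons p s) = height p + rise s.
Proof. by rewrite /height big_rcons. Qed.

Lemma height_le_size p : height p <= (size p)%:Z.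
Proof.
elim/last_ind: p => [|p s IH]; first by rewrite /height big_nil.
rewrite height_rcons size_rcons -addn1 PoszD lerD //.
by case: s => //= j; apply: (@le_trans _ _ 0); rewrite // oppr_le0.
Qed.

Lemma M2_down_lt p i j :
  M2 p -> (i < size p)%N -> nth Up p i = Down j -> (j < size p)%N.
Proof.
case=> pos _ ip pij; have := pos i.+1.
rewrite (take_nth Up ip) height_rcons pij /= subr_ge0 => le_j.
have := le_trans le_j (height_le_size (take i p)).
by rewrite size_takel ?(ltnW ip) // lez_nat => /leq_trans; apply; apply: ltnW.
Qed.

Lemma finite_M2_paths n k : finite_set (M2_paths n k).
Proof.
pose dec (i : 'I_n.+2) : step :=
  match val i with 0%N => Up | 1%N => Horiz | j.+2 => Down j end.
apply: (@sub_finite_set _ _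
  [set map dec (val x) | x in [set: n.-tuple 'I_n.+2]]).
  move=> p [M2p sp _].
  pose enc s : 'I_n.+2 :=
    match s with Up => ord0 | Horiz => inord 1 | Down j => inord j.+2 end.
  exists (map_tuple enc (tcast sp (in_tuple p))) => //=.
  rewrite val_tcast /= -map_comp -[RHS]map_id.
  apply/eq_in_map => s /(nthP Up) [i ip <-] /=.
  case E: (nth Up p i) => [||j] //=; rewrite /dec /= inordK //.
  by rewrite !ltnS -sp (M2_down_lt M2p ip E).
exact/finite_image/finite_finset.
Qed.

Lemma t_neg n (k : int) : k < 0 -> t n k = 0%N.
Proof.
move=> k0; rewrite /t (_ : M2_paths n k = set0) ?fset_set0 ?cardfs0 //.
apply/seteqP; split=> // p [[pos _] _ hk].
by have := pos (size p); rewrite take_size hk leNgt k0.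
Qed.

Record fps (R : Type) := FPS { fps_coef :> nat -> R }.

Lemma fpsP (R : Type) (f g : fps R) : (forall n, f n = g n) -> f = g.
Proof. by case: f g => [f] [g] /= /funext ->. Qed.

HB.instance Definition _ (R : Type) := gen_eqMixin (fps R).
HB.instance Definition _ (R : Type) := gen_choiceMixin (fps R).

Definition fps0 (R : zmodType) : fps R := FPS (fun=> 0).
Definition fps_opp (R : zmodType) (f : fps R) : fps R := FPS (fun n => - f n).
Definition fps_add (R : zmodType) (f g : fps R) : fps R :=
  FPS (fun n => f n + g n).

Lemma fps_addA (R : zmodType) : associative (@fps_add R).
Proof. by move=> f g h; apply: fpsP => n /=; rewrite addrA. Qed.
Lemma fps_addC (R : zmodType) : commutative (@fps_add R).
Proof. by move=> f g; apply: fpsP => n /=; rewrite addrC. Qed.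
Lemma fps_add0 (R : zmodType) : left_id (fps0 R) (@fps_add R).
Proof. by move=> f; apply: fpsP => n /=; rewrite add0r. Qed.
Lemma fps_addN (R : zmodType) : left_inverse (fps0 R) (@fps_opp R) (@fps_add R).
Proof. by move=> f; apply: fpsP => n /=; rewrite addNr. Qed.

HB.instance Definition _ (R : zmodType) := GRing.isZmodule.Build (fps R)
  (@fps_addA R) (@fps_addC R) (@fps_add0 R) (@fps_addN R).

Definition fpsC (R : nzRingType) (a : R) : fps R :=
  FPS (fun n => if n == 0%N then a else 0).
Definition fpsX (R : nzRingType) : fps R := FPS (fun n => (n == 1%N)%:R).
Definition fps_mul (R : nzRingType) (f g : fps R) : fps R :=
  FPS (fun n => \sum_(i < n.+1) f i * g (n - i)%N).

Definition fps_trunc (R : nzRingType) (m : nat) (f : fps R) : {poly R} :=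
  \poly_(i < m.+1) f i.

Lemma coef_trunc (R : nzRingType) m (f : fps R) n :
  (n <= m)%N -> (fps_trunc m f)`_n = f n.
Proof. by move=> nm; rewrite coef_poly ltnS nm. Qed.

Lemma coef_trunc_mul (R : nzRingType) m (f g : fps R) n :
  (n <= m)%N -> (fps_trunc m f * fps_trunc m g)`_n = fps_mul f g n.
Proof.
move=> nm; rewrite coefM /=; apply: eq_bigr => i _.
by rewrite !coef_trunc ?(leq_trans (leq_subr _ _)) // (leq_trans (leq_ord i)).
Qed.

Lemma fps_mulA (R : comNzRingType) : associative (@fps_mul R).
Proof.
move=> f g h; apply: fpsP => n.
transitivity ((fps_trunc n f * (fps_trunc n g * fps_trunc n h))`_n).
  rewrite coefM; apply: eq_bigr => i _.
  by rewrite coef_trunc ?leq_ord // coef_trunc_mul ?leq_subr.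
rewrite mulrA coefM; apply: eq_bigr => i _.
by rewrite coef_trunc ?leq_subr // coef_trunc_mul ?leq_ord.
Qed.

Lemma fps_mulC (R : comNzRingType) : commutative (@fps_mul R).
Proof.
by move=> f g; apply: fpsP => n; rewrite -!(coef_trunc_mul _ _ (leqnn n)) mulrC.
Qed.

Lemma fps_mul1 (R : comNzRingType) : left_id (fpsC (1 : R)) (@fps_mul R).
Proof.
move=> f; apply: fpsP => n /=; rewrite big_ord_recl /= mul1r subn0.
by rewrite big1 ?addr0 // => i _; rewrite mul0r.
Qed.

Lemma fps_mulDl (R : comNzRingType) :
  left_distributive (@fps_mul R) (@fps_add R).
Proof.
move=> f g h; apply: fpsP => n /=; rewrite -big_split /=.
by apply: eq_bigr => i _; rewrite mulrDl.
Qed.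

Lemma fps_1_neq0 (R : comNzRingType) : fpsC (1 : R) != fps0 R.
Proof.
apply/eqP => /(congr1 (fun f : fps R => f 0%N)) /= /eqP.
by rewrite (negbTE (oner_neq0 R)).
Qed.

HB.instance Definition _ (R : comNzRingType) :=
  GRing.Zmodule_isComNzRing.Build (fps R)
    (@fps_mulA R) (@fps_mulC R) (@fps_mul1 R) (@fps_mulDl R) (@fps_1_neq0 R).

Lemma fps0E (R : zmodType) n : (0 : fps R) n = 0. Proof. by []. Qed.
Lemma fpsDE (R : zmodType) (f g : fps R) n : (f + g) n = f n + g n.
Proof. by []. Qed.
Lemma fpsNE (R : zmodType) (f : fps R) n : (- f) n = - f n.
Proof. by []. Qed.
Lemma fps1E (R : comNzRingType) n : (1 : fps R) n = (n == 0%N)%:R.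
Proof. by case: n. Qed.
Lemma fpsME (R : comNzRingType) (f g : fps R) n :
  (f * g) n = \sum_(i < n.+1) f i * g (n - i)%N.
Proof. by []. Qed.

Lemma fpsMnE (R : zmodType) (f : fps R) m n : (f *+ m) n = f n *+ m.
Proof. by elim: m => [|m IH] //; rewrite !mulrSr fpsDE IH. Qed.

Lemma fpsXM (R : comNzRingType) (f : fps R) n :
  (fpsX R * f) n = if n is m.+1 then f m else 0.
Proof.
case: n => [|n]; rewrite fpsME big_ord_recl /= mul0r ?add0r ?big_ord0 //.
rewrite big_ord_recl /= mul1r subSS subn0 big1 ?addr0 // => i _.
by rewrite mul0r.
Qed.

Lemma fpsXnE (R : comNzRingType) m n : (fpsX R ^+ m) n = (n == m)%:R.
Proof.
by elim: m n => [|m IH] [|n]; rewrite ?expr0 ?fps1E // exprS fpsXM ?IH.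
Qed.

Lemma fpsCM (R : comNzRingType) a (f : fps R) n : (fpsC a * f) n = a * f n.
Proof.
rewrite fpsME big_ord_recl /= subn0 big1 ?addr0 // => i _.
by rewrite mul0r.
Qed.

(* Course-of-values recursion: the n-th value is [F] applied to the list of
   the n previous ones. *)
Fixpoint cov_prefix (T : Type) (F : seq T -> T) (n : nat) : seq T :=
  if n is m.+1 then rcons (cov_prefix F m) (F (cov_prefix F m)) else [::].
Definition cov (T : Type) (F : seq T -> T) (n : nat) : T := F (cov_prefix F n).

Lemma cov_prefixE (T : Type) (F : seq T -> T) n :
  cov_prefix F n = mkseq (cov F) n.
Proof.
by elim: n => //= n IH; rewrite /mkseq -addn1 iotaD map_cat -cats1 -/(mkseq _ _) -IH.
Qed.

Lemma covE (T : Type) (F : seq T -> T) n : cov F n = F (mkseq (cov F) n).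
Proof. by rewrite -cov_prefixE. Qed.

Definition fps_unit (R : comUnitRingType) : pred (fps R) :=
  fun f => f 0%N \is a GRing.unit.

Definition fps_inv_step (R : comUnitRingType) (f : fps R) (s : seq R) : R :=
  if s is [::] then (f 0%N)^-1
  else - (f 0%N)^-1 * \sum_(i < size s) s`_i * f (size s - i)%N.

Definition fps_inv (R : comUnitRingType) (f : fps R) : fps R :=
  if fps_unit f then FPS (cov (fps_inv_step f)) else f.

Lemma fps_mulVr (R : comUnitRingType) :
  {in @fps_unit R, left_inverse 1 (@fps_inv R) *%R}.
Proof.
move=> f uf; rewrite /fps_inv ifT //.
apply: fpsP => n; rewrite fpsME fps1E big_ord_recr /= subnn.
case: n => [|n]; first by rewrite big_ord0 add0r covE /= mulVr.
rewrite [cov _ n.+1]covE /= -/(mkseq _ _) size_map size_iota.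
rewrite mulrAC mulNr mulVr // mulN1r.
apply/eqP; rewrite subr_eq0; apply/eqP/eq_bigr => i _.
by rewrite (nth_mkseq _ (cov (fps_inv_step f)) (ltn_ord i)).
Qed.

Lemma fps_unitP (R : comUnitRingType) (f g : fps R) : g * f = 1 -> fps_unit f.
Proof.
move=> /(congr1 (fun h : fps R => h 0%N)); rewrite fpsME big_ord1 fps1E /= => gf.
by apply/unitrP; exists (g 0%N); split; rewrite // mulrC.
Qed.

Lemma fps_inv_out (R : comUnitRingType) :
  {in [predC @fps_unit R], @fps_inv R =1 id}.
Proof. by move=> f nuf; rewrite /fps_inv ifN. Qed.

HB.instance Definition _ (R : comUnitRingType) :=
  GRing.ComNzRing_hasMulInverse.Build (fps R)
    (@fps_mulVr R) (@fps_unitP R) (@fps_inv_out R).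

Lemma fps_unitE (R : comUnitRingType) (f : fps R) :
  (f \is a GRing.unit) = (f 0%N \is a GRing.unit).
Proof. by []. Qed.

Lemma fps_order (R : comNzRingType) (f : fps R) : f != 0 ->
  exists m, exists2 g : fps R, g 0%N != 0 & f = fpsX R ^+ m * g.
Proof.
move=> f0; have [|m fm min_m] := @ex_minnP (fun n => f n != 0).
  apply: contrapT => nf; case/eqP: f0; apply: fpsP => n.
  by apply/eqP/negPn/negP => fn; apply: nf; exists n.
exists m, (FPS (fun n => f (m + n)%N)); first by rewrite /= addn0.
elim: m f {f0} fm min_m => [|m IH] f fm min_m.
  by rewrite expr0 mul1r; apply: fpsP.
rewrite exprS -mulrA -(IH (FPS (fun n => f n.+1))) //.
  apply: fpsP => -[|n]; rewrite fpsXM //; apply/eqP/negPn/negP.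
  by move/min_m.
by move=> n /min_m.
Qed.

Lemma fps_integral (R : idomainType) :
  GRing.integral_domain_axiom (fps R).
Proof.
move=> f g fg0; apply/norP => -[].
move=> /fps_order [m [f' f'0 Ef]] /fps_order [n [g' g'0 Eg]].
have : (fpsX R ^+ (m + n) * (f' * g')) (m + n)%N = 0.
  by rewrite exprD mulrACA -Ef -Eg fg0.
rewrite fpsME big_ord_recr /= subnn big1 => [|i _].
  rewrite add0r fpsXnE eqxx mul1r big_ord1 subnn => /eqP.
  by rewrite mulf_eq0 (negbTE f'0) (negbTE g'0).
by rewrite fpsXnE (ltn_eqF (ltn_ord i)) mul0r.
Qed.

HB.instance Definition _ (R : idomainType) :=
  GRing.ComUnitRing_isIntegral.Build (fps R) (@fps_integral R).

Lemma fpsX_neq0 (R : comNzRingType) : fpsX R != 0.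
Proof.
apply/eqP => /(congr1 (fun f : fps R => f 1%N)) /eqP.
by rewrite fps0E /= (negbTE (oner_neq0 R)).
Qed.

(* The expansion of 1/(a - u) in powers of u, for an invertible constant a. *)
Lemma fps_inv_subX (F : fieldType) (a : F) : a != 0 ->
  (fpsC a - fpsX F)^-1 = FPS (fun k => a ^- k.+1).
Proof.
move=> a0; set g := FPS _.
have Eg : (fpsC a - fpsX F) * g = 1.
  apply: fpsP => n; rewrite mulrBl fpsDE fpsNE fpsCM fpsXM fps1E /g /=.
  case: n => [|n]; first by rewrite subr0 expr1 divff.
  by rewrite exprS invfM mulrA divff // mul1r subrr.
have u : (fpsC a - fpsX F) \is a GRing.unit.
  by rewrite fps_unitE fpsDE fpsNE /= subr0 unitfE.
by apply: (mulrI u); rewrite Eg mulrV.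
Qed.

Definition fps_sqrt_step (F : fieldType) (f : fps F) (s : seq F) : F :=
  if s is [::] then 1
  else (f (size s) - \sum_(1 <= i < size s) s`_i * s`_(size s - i)) / 2%:R.

(* The square root with constant term 1; see [fps_sqrtK], [fps_sqrt_unique]. *)
Definition fps_sqrt (F : fieldType) (f : fps F) : fps F :=
  FPS (cov (fps_sqrt_step f)).

Lemma fps_sqrt_coef0 (F : fieldType) (f : fps F) : fps_sqrt f 0%N = 1.
Proof. by []. Qed.

Lemma fps_sqrt_coefS (F : fieldType) (f : fps F) n :
  fps_sqrt f n.+1 = (f n.+1 -
    \sum_(1 <= i < n.+1) fps_sqrt f i * fps_sqrt f (n.+1 - i)%N) / 2%:R.
Proof.
rewrite [LHS]covE; have : size (mkseq (cov (fps_sqrt_step f)) n.+1) = n.+1.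
  exact: size_mkseq.
have : forall i, (i < n.+1)%N ->
  (mkseq (cov (fps_sqrt_step f)) n.+1)`_i = fps_sqrt f i.
  by move=> i; apply: nth_mkseq.
case: (mkseq _ _) => // a s nthE sz; rewrite /fps_sqrt_step sz.
congr ((_ - _) / _); apply: eq_big_nat => i /andP[i1 i2].
by rewrite !nthE // ltn_subrL i1.
Qed.

Lemma fps_sqrtK (F : numFieldType) (f : fps F) :
  f 0%N = 1 -> fps_sqrt f ^+ 2 = f.
Proof.
move=> f0; apply: fpsP => -[|n]; rewrite expr2 fpsME.
  by rewrite big_ord1 f0 fps_sqrt_coef0 mulr1.
rewrite -(big_mkord xpredT (fun i => fps_sqrt f i * fps_sqrt f (n.+1 - i)%N)).
rewrite big_nat_recr // big_ltn // subnn subn0 fps_sqrt_coef0 mul1r mulr1.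
set S := \sum_(1 <= i < n.+1) _.
rewrite fps_sqrt_coefS -/S.
change ((f n.+1 - S) / 2%:R + S + (f n.+1 - S) / 2%:R = f n.+1).
by rewrite addrAC -splitr subrK.
Qed.

Lemma fps_sqrt_unique (F : numFieldType) (f g : fps F) :
  g 0%N = 1 -> g ^+ 2 = f -> g = fps_sqrt f.
Proof.
move=> g0 g2; have f0 : f 0%N = 1 by rewrite -g2 expr2 fpsME big_ord1 g0 mulr1.
have /eqP := fps_sqrtK f0; rewrite -{2}g2 eqf_sqr => /orP[/eqP //|/eqP E].
have /eqP : fps_sqrt f 0%N = - 1 by rewrite E fpsNE g0.
by rewrite fps_sqrt_coef0 -subr_eq0 opprK -(natrD _ 1 1) pnatr_eq0.
Qed.

(* The field Q((z)), as the field of fractions of Q[[z]]; [_%:F] is the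
   inclusion of Q[[z]].  See [laurentP]. *)
Notation "x %:F" := (@FracField.tofrac _ x) : ring_scope.

Definition laurent : fieldType := {fraction (fps rat)}.

Definition z : fps rat := fpsX rat.
Definition zL : laurent := z%:F.

Lemma laurentP (x : laurent) :
  exists m, exists f : fps rat, x = f%:F / zL ^+ m.
Proof.
have [a [b [b0 ->]]] : exists a b : fps rat, b != 0 /\ x = a%:F / b%:F.
  elim/quotW: x => y; exists (\n_y), (\d_y); split; first exact: denom_ratioP.
  apply: (@mulIf _ (\d_y)%:F); first by rewrite tofrac_eq0 denom_ratioP.
  rewrite divfK ?tofrac_eq0 ?denom_ratioP //; unlock FracField.tofrac.
  rewrite -[LHS]FracField.pi_mul; apply/eqmodP => /=.
  rewrite /FracField.equivf /FracField.mulf !numden_Ratio ?oner_eq0 ?mulr1 ?denom_ratioP //.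
  by rewrite mulrC.
have [m [g g0 Eb]] := fps_order b0.
have ug : g \is a GRing.unit by rewrite fps_unitE unitfE.
have gF : g%:F != 0 :> laurent.
  by rewrite tofrac_eq0; apply: contraTneq ug => ->; rewrite unitr0.
exists m, (a / g); rewrite Eb tofracM tofracXn invfM tofracM.
have -> : (g^-1)%:F = g%:F^-1 :> laurent.
  by apply: (mulfI gF); rewrite -tofracM mulrV // tofrac1 divff.
by rewrite mulrA [in RHS]mulrAC mulrAC.
Qed.

Definition r : laurent :=
  (z + 1 + fps_sqrt (1 - 2%:R * z - 3%:R * z ^+ 2))%:F
    / (2%:R * z * (z + 1))%:F.

Lemma r_neq0 : r != 0.
Proof.
rewrite /r mulf_neq0 ?invr_eq0 // tofrac_eq0; apply/eqP.
  move=> /(congr1 (fun f : fps rat => f 0%N)).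
  by rewrite fps0E !fpsDE fps_sqrt_coef0 fps1E /=.
move=> /(congr1 (fun f : fps rat => f 1%N)).
by rewrite -mulrA mulr_natl fpsMnE fpsXM fpsDE fps1E.
Qed.

(* Q((z))[[u]], where both the generating function and 1/(r - u) live; by
   [fps_inv_subX] and [r_neq0], 1/(r - u) is \sum_k u^k / r^(k+1). *)
Definition u : fps laurent := fpsX laurent.

(* The coefficient of u^k is the series \sum_n t(n,k) z^n. *)
Definition Total : fps laurent :=
  FPS (fun k : nat => (FPS (fun n : nat => (t n k%:Z)%:R : rat))%:F).

(* Main.v *)
Require Import Defs.
From mathcomp Require Import ring zify.

Set Implicit Arguments.
Unset Strict Implicit.
Unset Printing Implicit Defensive.

Import Order.TTheory GRing.Theory Num.Theory.
Local Open Scope ring_scope.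

(** Removing the last step of a path gives the recurrence: a path ends with U,
    or it ends with H or some D_j, in which case it is called blocked, because
    only U can follow.  The paths of length n+1 and height k that end with U
    correspond to all the paths of length n and height k-1 ([t_split]).
    Lowering the end of a blocked path by one unit (H becomes D_1, D_j becomes
    D_(j+1)) gives a blocked path again, and for lengths at least 2 the only
    blocked paths not obtained in this way are those that end with U H
    ([card_blocked]).  Subtracting the decompositions at heights k and k-1
    gives the recurrence ([t_rec]).

    Read downwards in k, this recurrence determines t from very few values:
    t(n,k) vanishes for k > n, and the recurrence expresses t(n,k-1) by t(n,k)
    and the rows n-1 and n-2.  Only the rows 0 and 1 are left to inspect
    ([triangle_unique]).

    The series r is a root of z(z+1) r^2 - (z+1) r + 1, so that 1/r = z tau
    where tau is the power series with (z+1)(tau-1) = z tau^2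
    ([tau_quadratic], [r_tau]).  Multiplying this equation by z^k tau^k
    shows that the coefficients of 1/(z r^(k+1)) = z^k tau^(k+1) satisfy the
    recurrence of t; they have the same rows 0 and 1 and also vanish for
    k > n.  Hence they are t(n,k) ([t_column]).  Summing over k gives the
    bivariate series, and the equation for tau, read coefficientwise, is the
    convolution formula for t(n,0) ([tau_convolution]). *)

(** * Cardinals of finite sets *)

Lemma card_fset_set_image (T U : choiceType) (f : T -> U) (A : set T) :
  finite_set A -> injective f ->
  #|` fset_set (f @` A)%classic| = #|` fset_set A|.
Proof. by move=> fA fI; rewrite fset_set_image // card_imfset. Qed.

Lemma card_fset_setU (T : choiceType) (A B : set T) :
  finite_set A -> finite_set B -> (forall x, A x -> ~ B x) ->
  #|` fset_set (A `|` B)%classic| = (#|` fset_set A| + #|` fset_set B|)%N.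
Proof.
move=> fA fB AB; rewrite fset_setU // cardfsU -fset_setI //.
rewrite (_ : (A `&` B)%classic = set0) ?fset_set0 ?cardfs0 ?subn0 //.
by rewrite -subset0 => x [/AB].
Qed.

(** * Paths and their last step *)

Lemma M2_nil : M2 [::].
Proof. by split=> // i; rewrite take_oversize // /height big_nil. Qed.

Lemma M2_rcons p s :
  M2 (rcons p s) <->
  [/\ M2 p, 0 <= height p + rise s & (s == Up) || (last Up p == Up)].
Proof.
have -> : (s == Up) || (last Up p == Up) = (last Up p != Up) ==> (s == Up).
  by rewrite implyNb orbC.
have sortE : sorted (fun s s' => (s != Up) ==> (s' == Up)) (rcons p s) =
    sorted (fun s s' => (s != Up) ==> (s' == Up)) p
    && ((last Up p != Up) ==> (s == Up)).
  by case: p => [|x p] //=; rewrite rcons_path.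
split=> [[pos]|[[pos srt] hs last_s]].
  rewrite sortE => /andP[srt last_s]; split=> //.
    split=> // i; have [ip|pi] := leqP i (size p).
      by have := pos i; rewrite -cats1 takel_cat.
    rewrite (take_oversize (ltnW pi)).
    by have := pos (size p); rewrite -cats1 take_size_cat.
  by have := pos (size p).+1; rewrite take_oversize ?size_rcons // height_rcons.
split; last by rewrite sortE srt.
move=> i; have [ip|pi] := leqP i (size p).
  by rewrite -cats1 takel_cat.
by rewrite take_oversize ?size_rcons // height_rcons.
Qed.

Lemma M2_paths_nil k p : M2_paths 0 k p <-> p = [::] /\ k = 0.
Proof.
split=> [[_ /size0nil -> <-]|[-> ->]]; first by rewrite /height big_nil.
by split=> //; [exact: M2_nil | rewrite /height big_nil].
Qed.

Lemma M2_paths_rcons n k p s :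
  M2_paths n.+1 k (rcons p s) <->
  [/\ M2_paths n (k - rise s) p, 0 <= k & (s == Up) || (last Up p == Up)].
Proof.
split=> [[/M2_rcons[M2p pos ok]]|[[M2p <- hp] k0 ok]].
  rewrite size_rcons height_rcons => -[sp] <-; split=> //.
  by split=> //; rewrite addrK.
by split; rewrite ?size_rcons ?height_rcons ?M2_rcons ?hp ?subrK.
Qed.

(** The default [Up] leaves out the empty path, which any step may follow. *)
Definition blocked n k : set (seq step) :=
  [set p | M2_paths n k p /\ last Up p != Up]%classic.

Lemma finite_blocked n k : finite_set (blocked n k).
Proof. by apply: sub_finite_set (@finite_M2_paths n k) => p []. Qed.

(** An up step may follow any path, so the paths that are not blocked
    correspond to the paths with one step less. *)
Lemma t_split n k : t n.+1 k = (t n (k - 1) + #|` fset_set (blocked n.+1 k)|)%N.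
Proof.
have -> : t n (k - 1) =
    #|` fset_set ((rcons^~ Up) @` M2_paths n (k - 1))%classic|.
  rewrite card_fset_set_image //; last exact: rcons_injl.
  exact: finite_M2_paths.
rewrite -card_fset_setU;
  [|exact/finite_image/finite_M2_paths|exact: finite_blocked|].
  congr #|` fset_set _|; apply/seteqP; split=> [p|p [[q Mq <-]|[]//]].
    case: (lastP p) => [[]//|q s] M.
    have [sU|sN] := eqVneq s Up; last by right; split=> //; rewrite last_rcons.
    by move: M; rewrite sU => /M2_paths_rcons[Mq _ _]; left; exists q.
  apply/M2_paths_rcons; split=> //; case: Mq => [[pos _] _ hq].
  by have := pos (size q); rewrite take_size hq subr_ge0; apply: le_trans.
by move=> _ [q _ <-] []; rewrite last_rcons.
Qed.

(** Lowers the end of a step by one unit.  Following this rule on [Up] as well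
    makes [sink] injective. *)
Definition sink (s : step) : step :=
  match s with Up => Horiz | Horiz => Down 0 | Down j => Down j.+1 end.

Definition sink_last (p : seq step) : seq step :=
  if p is s :: q then rcons (belast s q) (sink (last s q)) else [::].

Lemma sink_inj : injective sink.
Proof. by case=> [||i] [||j] //= [->]. Qed.

Lemma rise_sink s : rise (sink s) = rise s - 1.
Proof. by case: s => //= j; lia. Qed.

Lemma sink_last_rcons p s : sink_last (rcons p s) = rcons p (sink s).
Proof. by case: p => //= x p; rewrite belast_rcons last_rcons. Qed.

Lemma sink_last_inj : injective sink_last.
Proof.
move=> p q; case/lastP: p => [|p s]; case/lastP: q => [|q s'] //.
- by rewrite sink_last_rcons; case: q.
- by rewrite sink_last_rcons; case: p.
by rewrite !sink_last_rcons => /rcons_inj[-> /sink_inj ->].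
Qed.

(** A blocked path of length at least 2 has the form p U s.  If s is a down
    step, raising its end by one unit gives a blocked path of which this one is
    the image under [sink_last]; if s = H, only p, which ends one unit lower,
    is left to choose.  The bound on k keeps lowered paths above the axis. *)
Lemma card_blocked n (k : int) : 1 <= k ->
  #|` fset_set (blocked n.+2 (k - 1))| =
  (#|` fset_set (blocked n.+2 k)| + t n (k - 2))%N.
Proof.
move=> k1.
rewrite -(card_fset_set_image (@finite_blocked n.+2 k) sink_last_inj).
pose peak p := rcons (rcons p Up) Horiz.
have peakI : injective peak by move=> p q /rcons_inj[/rcons_inj[]].
rewrite /t -(card_fset_set_image (@finite_M2_paths n (k - 2)) peakI).
rewrite -card_fset_setU;
  [|exact/finite_image/finite_blocked|exact/finite_image/finite_M2_paths|].
  congr #|` fset_set _|; apply/seteqP; split=> [p []|p].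
    case: (lastP p) => [[]//|q s] M; case/M2_paths_rcons: M => [Mq k1_ge0 ok].
    rewrite last_rcons => sN; move: ok; rewrite (negbTE sN) /= => /eqP qU.
    have [sH|[s' Es s'N]] : s = Horiz \/ exists2 s', s = sink s' & s' != Up.
      case: (s) sN => [||[|j]] //= _; first by left.
        by right; exists Horiz.
      by right; exists (Down j).
      right; case/lastP: q Mq qU => [[]//|q s'] Mq.
      rewrite last_rcons => Es'; exists q; last by rewrite /peak sH Es'.
      move: Mq; rewrite sH Es' => /M2_paths_rcons[+ _ _].
      by congr (M2_paths n _ q); rewrite /=; lia.
    left; exists (rcons q s'); last by rewrite sink_last_rcons Es.
    split; last by rewrite last_rcons.
    apply/M2_paths_rcons; split; [|lia|by rewrite qU eqxx orbT].
    by move: Mq; rewrite Es rise_sink; congr (M2_paths _ _ q); lia.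
  case=> [[q [+ qN] <-]|[q Mq <-]].
    case: (lastP q) qN => [[]//|{}q s]; rewrite last_rcons => sN.
    case/M2_paths_rcons=> [Mq _]; rewrite (negbTE sN) /= => qU.
    rewrite sink_last_rcons; split; last by rewrite last_rcons; case: (s) sN.
    apply/M2_paths_rcons; rewrite qU orbT; split=> //; last by lia.
    by move: Mq; rewrite rise_sink; congr (M2_paths _ _ q); lia.
  have k2 : 0 <= k - 2.
    by case: Mq => -[pos _] _ <-; have := pos (size q); rewrite take_size.
  split; last by rewrite last_rcons.
  apply/M2_paths_rcons; rewrite last_rcons; split=> //; last by lia.
  apply/M2_paths_rcons; split=> //=; last by lia.
  by move: Mq; congr (M2_paths _ _ q); lia.
move=> _ [p [_ pN] <-] [q _]; case/lastP: p pN => // p s.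
rewrite last_rcons sink_last_rcons /peak => sN /rcons_inj[_].
by case: (s) sN.
Qed.

(** [t_split] at heights k and k-1, with the blocked paths eliminated by
    [card_blocked]. *)
Lemma t_rec n (k : int) : 1 <= k ->
  (t n.+2 k + t n.+1 (k - 2) + t n (k - 2) = t n.+2 (k - 1) + t n.+1 (k - 1))%N.
Proof.
move=> k1; rewrite !(t_split n.+1) card_blocked //.
rewrite (_ : k - 1 - 1 = k - 2); [ring|lia].
Qed.

Lemma t_gt n k : n%:Z < k -> t n k = 0%N.
Proof.
move=> nk; rewrite /t (_ : M2_paths n k = set0) ?fset_set0 ?cardfs0 //.
rewrite -subset0 => p [_ sp hp]; have := height_le_size p.
by rewrite sp hp leNgt nk.
Qed.

Lemma t00 : t 0 0 = 1%N.
Proof.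
rewrite /t (_ : M2_paths 0 0 = [set [::]]%classic) ?fset_set1 ?cardfs1 //.
by apply/seteqP; split=> p; [case/M2_paths_nil | move=> ->; apply/M2_paths_nil].
Qed.

Lemma card_blocked1 k : #|` fset_set (blocked 1 k)| = (k == 0).
Proof.
have memE s : blocked 1 k [:: s] <-> s = Horiz /\ k = 0.
  split=> [[/(@M2_paths_rcons 0 k [::])[/M2_paths_nil[_ ks] k0 _] /=]|[-> ->]].
    by case: s ks => [||j] //= ks _; [split=> //; lia | lia].
  split=> //; apply/(@M2_paths_rcons 0 0 [::]); split=> //.
  exact/M2_paths_nil.
have [k0|kN] := eqVneq k 0.
  rewrite (_ : blocked 1 k = [set [:: Horiz]]%classic) ?fset_set1 ?cardfs1 //.
  apply/seteqP; split=> [p Bp|_ ->]; last exact/memE.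
  have [[_ sp _] _] := Bp; case: p sp Bp => [|s [|//]] // _.
  by case/memE=> ->.
rewrite (_ : blocked 1 k = set0) ?fset_set0 ?cardfs0 // -subset0 => p Bp.
have [[_ sp _] _] := Bp; case: p sp Bp => [|s [|//]] // _.
by case/memE=> _ /eqP; rewrite (negbTE kN).
Qed.

Lemma t10 : t 1 0 = 1%N.
Proof. by rewrite t_split card_blocked1 t_neg. Qed.

Lemma t11 : t 1 1 = 1%N.
Proof. by rewrite t_split card_blocked1 subrr t00. Qed.

(** * Uniqueness of the solution of the recurrence *)

(** The recurrence gives the entry (n+2,k) from the entry (n+2,k+1) and the two
    previous rows, and each row is known far to the right: hence an induction
    on n, and in each row a descending induction on k. *)
Lemma triangle_unique (f g : nat -> nat -> rat) :
  (forall n k, f n.+2 k.+1 =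
     f n.+2 k + f n.+1 k - (if k is j.+1 then f n.+1 j + f n j else 0)) ->
  (forall n k, g n.+2 k.+1 =
     g n.+2 k + g n.+1 k - (if k is j.+1 then g n.+1 j + g n j else 0)) ->
  (forall n k, (n < k)%N -> f n k = g n k) ->
  f 0%N 0%N = g 0%N 0%N -> f 1%N 0%N = g 1%N 0%N -> f 1%N 1%N = g 1%N 1%N ->
  forall n k, f n k = g n k.
Proof.
move=> recf recg gt fg00 fg10 fg11 n.
suff: (forall k, f n k = g n k) /\ (forall k, f n.+1 k = g n.+1 k) by case.
elim: n => [|n [IHn IHn1]].
  by split=> [[|k]|[|[|k]]] //; apply: gt.
(* m bounds the distance from column k to the first column on the right of
   which the two triangles are known to agree. *)
split=> // k; have [m le_m] : exists m, (n.+2 < k + m)%N by exists n.+3; lia.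
elim: m k le_m => [|m IHm] k; first by rewrite addn0; apply: gt.
rewrite addnS -addSn => /IHm; rewrite recf recg IHn1.
by case: k => [|k]; rewrite ?IHn ?IHn1 => /addIr/addIr.
Qed.

(** * The power series z^k tau^(k+1) *)

Lemma fpsC_inv (F : fieldType) (a : F) : a != 0 -> fpsC a^-1 = (fpsC a)^-1.
Proof.
move=> a0; have a_unit : fpsC a \is a GRing.unit by rewrite fps_unitE unitfE.
apply: (mulrI a_unit); rewrite (mulrV a_unit); apply: fpsP => k.
by rewrite fpsCM fps1E; case: k => [|k] /=; rewrite ?mulfV ?mulr0.
Qed.

Lemma coef_zM0 (f : fps rat) : (z * f) 0%N = 0.
Proof. by rewrite fpsXM. Qed.

Lemma coef_zMS (f : fps rat) n : (z * f) n.+1 = f n.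
Proof. by rewrite fpsXM. Qed.

Lemma coef_sqrS (f : fps rat) n : f 0%N = 1 ->
  (f ^+ 2) n.+1 = f n.+1 + f n.+1 + \sum_(1 <= i < n.+1) f i * f (n.+1 - i)%N.
Proof.
move=> f0; rewrite expr2 fpsME.
rewrite -(big_mkord xpredT (fun i => f i * f (n.+1 - i)%N)).
rewrite big_nat_recr // big_ltn //= subnn subn0 f0 mul1r mulr1.
by rewrite [LHS]addrAC.
Qed.

Definition disc : fps rat := 1 - 2%:R * z - 3%:R * z ^+ 2.

Lemma sqrt_discK : fps_sqrt disc ^+ 2 = disc.
Proof.
apply: fps_sqrtK; rewrite (_ : disc = 1 - z * (2%:R + 3%:R * z)).
  by rewrite fpsDE fpsNE fps1E fpsXM subr0.
rewrite /disc; ring.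
Qed.

Lemma fps_divX (f : fps rat) : f 0%N = 0 -> f = z * FPS (fun n => f n.+1).
Proof. by move=> f0; apply: fpsP => -[|n]; rewrite fpsXM. Qed.

(** The series (z + 1 - sqrt disc) / (2z): the shift of the coefficients divides
    by z, and the sign of the root makes the numerator divisible. *)
Definition tau : fps rat :=
  FPS (fun n => (z + 1 - fps_sqrt disc) n.+1 / 2%:R).

Lemma two_z_tau : 2%:R * (z * tau) = z + 1 - fps_sqrt disc.
Proof.
rewrite [RHS]fps_divX; last by rewrite !fpsDE fpsNE fps1E /= add0r subrr.
rewrite mulrCA; congr (z * _); apply: fpsP => n.
by rewrite mulr_natl fpsMnE -mulr_natr; apply: divfK.
Qed.

Lemma two_neq0 : 2%:R != 0 :> fps rat.
Proof.
apply/eqP => /(congr1 (fun f : fps rat => f 0%N)).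
by rewrite fpsMnE fps1E.
Qed.

Lemma z_neq0 : z != 0. Proof. exact: fpsX_neq0. Qed.

Lemma tau_quadratic : (z + 1) * (tau - 1) = z * tau ^+ 2.
Proof.
apply: (mulfI (mulf_neq0 (mulf_neq0 two_neq0 two_neq0) z_neq0)).
have E : (z + 1 - 2%:R * (z * tau)) ^+ 2 = disc.
  by rewrite two_z_tau subKr sqrt_discK.
apply/eqP; rewrite -subr_eq0; apply/eqP.
transitivity (disc - (z + 1 - 2%:R * (z * tau)) ^+ 2); last by rewrite E subrr.
rewrite /disc; ring.
Qed.

Lemma tau0 : tau 0%N = 1.
Proof.
have := congr1 (fun f : fps rat => f 0%N) tau_quadratic.
rewrite mulrDl mul1r fpsDE !coef_zM0 add0r fpsDE fpsNE fps1E => /eqP.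
by rewrite subr_eq0 => /eqP.
Qed.

Lemma tau1 : tau 1%N = 1.
Proof.
have := congr1 (fun f : fps rat => f 1%N) tau_quadratic.
rewrite mulrDl mul1r fpsDE !coef_zMS !fpsDE !fpsNE !fps1E tau0 expr2 fpsME.
by rewrite big_ord1 subnn tau0 subrr add0r subr0 mulr1.
Qed.

(** The coefficient of z^(n+2) in [tau_quadratic]: the extreme terms of the
    square contribute 2 tau_(n+1), half of which cancels against the left-hand
    side. *)
Lemma tau_convolution n : tau n.+2 =
  tau n.+1 + \sum_(1 <= k < n.+1) tau k * tau (n.+1 - k)%N.
Proof.
have := congr1 (fun f : fps rat => f n.+2) tau_quadratic.
rewrite mulrDl mul1r fpsDE !coef_zMS !fpsDE !fpsNE !fps1E !subr0.
by rewrite coef_sqrS ?tau0 // -addrA => /addrI.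
Qed.

(** The conjugate factors z + 1 + sqrt disc and z + 1 - sqrt disc have product
    (z + 1)^2 - disc = 4 z (z + 1). *)
Lemma r_tau : r * (zL * tau%:F) = 1.
Proof.
have zz : (2%:R * z * (z + 1))%:F != 0 :> laurent.
  rewrite tofrac_eq0 !mulf_neq0 ?two_neq0 ?z_neq0 //.
  apply/eqP => /(congr1 (fun f : fps rat => f 0%N)).
  by rewrite fpsDE fps1E.
rewrite /r mulrAC -tofracM -/disc.
apply: (canLR (mulfK zz)); rewrite mul1r -tofracM; congr (_%:F).
apply: (mulfI two_neq0).
transitivity ((z + 1 + fps_sqrt disc) * (2%:R * (z * tau))); first by ring.
rewrite two_z_tau mulrC -subr_sqr sqrt_discK /disc; ring.
Qed.

Definition column k : fps rat := z ^+ k * tau ^+ k.+1.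

Lemma columnE k : (column k)%:F = 1 / (zL * r ^+ k.+1).
Proof.
have zL0 : zL != 0 by rewrite tofrac_eq0 z_neq0.
have x0 : zL * tau%:F != 0.
  by apply: contra_eq_neq r_tau => ->; rewrite mulr0 eq_sym oner_neq0.
have -> : r = (zL * tau%:F)^-1 by apply: (mulIf x0); rewrite r_tau mulVf.
rewrite exprVn mul1r invfM invrK exprMn exprS mulrA mulrA mulVf // mul1r.
by rewrite /column tofracM !tofracXn.
Qed.

Lemma column_gt n k : (n < k)%N -> column k n = 0.
Proof.
rewrite /column; elim: k n (tau ^+ k.+1) => // k IH [|n] f nk;
  by rewrite exprS -mulrA fpsXM ?IH.
Qed.

(** [tau_quadratic] multiplied by z^k tau^k.  For k = 0 the term 1 stands for
    z column(-1), as z^(-1) tau^0 is not a power series. *)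
Lemma column_rec k :
  column k.+1 = (z + 1) * (column k - (if k is j.+1 then z * column j else 1)).
Proof.
case: k => [|k]; rewrite /column.
  by rewrite !expr1 expr0 mul1r -tau_quadratic.
transitivity (z ^+ k.+1 * tau ^+ k.+1 * (z * tau ^+ 2)).
  by rewrite !exprS; ring.
rewrite -tau_quadratic !exprS; ring.
Qed.

Lemma coef_column_rec n k : column k.+1 n.+2 =
  column k n.+2 + column k n.+1 -
  (if k is j.+1 then column j n.+1 + column j n else 0).
Proof.
rewrite column_rec; case: k => [|k].
  rewrite mulrDl mul1r fpsDE coef_zMS !fpsDE !fpsNE !fps1E !subr0.
  exact: addrC.
move: (column k.+1) (column k) => f g.
rewrite mulrDl mul1r fpsDE coef_zMS !fpsDE !fpsNE !coef_zMS; ring.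
Qed.

(** * Paths and power series *)

Lemma t_column n k : (t n k%:Z)%:R = column k n.
Proof.
move: n k; apply: (@triangle_unique (fun n k => (t n k%:Z)%:R)
                     (fun n k => column k n)) => [n k|n k|n k nk|||].
- have : (1 : int) <= k.+1%:Z by [].
  move/(t_rec n); have -> : k.+1%:Z - 1 = k%:Z by lia.
  case: k => [|k].
    by rewrite !(@t_neg _ (1%:Z - 2)) // !addn0 subr0 -natrD => <-.
  have -> : k.+2%:Z - 2 = k%:Z by lia.
  by move=> E; rewrite -[X in X - _]natrD -E -addnA !natrD addrK.
- exact: coef_column_rec.
- by rewrite column_gt // t_gt.
- by rewrite t00 /column expr0 mul1r expr1 tau0.
- by rewrite t10 /column expr0 mul1r expr1 tau1.
by rewrite t11 /column expr1 coef_zMS expr2 fpsME big_ord1 tau0 mulr1.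
Qed.

Lemma t0_tau n : (t n 0)%:R = tau n.
Proof. by rewrite (t_column n 0) /column expr0 mul1r expr1. Qed.

Lemma TotalE k : Total k = 1 / (zL * r ^+ k.+1).
Proof.
rewrite -columnE; congr (_%:F); apply: fpsP => n; exact: t_column.
Qed.

Theorem theorem3 :
  [/\ Total = 1 / (fpsC zL * (fpsC r - u)),
      (forall k : nat, Total k = 1 / (zL * r ^+ k.+1)),
      (forall (n : nat) (k : int), (2 <= n)%N -> 1 <= k ->
         (t n k)%:Z = (t n (k - 1))%:Z + (t (n - 1) (k - 1))%:Z
                      - (t (n - 1) (k - 2))%:Z - (t (n - 2) (k - 2))%:Z)
    & (forall n : nat, (2 <= n)%N ->
         t n 0 = (t (n - 1) 0
                  + \sum_(1 <= k < n - 1) t k 0 * t (n - 1 - k) 0)%N)].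
Proof.
split.
- have zL0 : zL != 0 by rewrite tofrac_eq0 z_neq0.
  have zL_unit : fpsC zL \is a GRing.unit by rewrite fps_unitE unitfE.
  have ru_unit : fpsC r - u \is a GRing.unit.
    by rewrite fps_unitE fpsDE fpsNE subr0 unitfE r_neq0.
  have -> : Total = fpsC zL^-1 * (fpsC r - u)^-1.
    apply: fpsP => k.
    by rewrite fps_inv_subX ?r_neq0 // fpsCM TotalE mul1r invfM.
  by rewrite (fpsC_inv zL0) mul1r (invrM zL_unit ru_unit) [LHS]mulrC.
- exact: TotalE.
- move=> [|[|n]] k // _ k1; have := t_rec n k1.
  by rewrite !subSS !subn0; lia.
move=> [|[|n]] // _; apply/eqP; rewrite -(eqr_nat rat) natrD natr_sum.
rewrite !subSS !subn0 !t0_tau tau_convolution; apply/eqP; congr (_ + _).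
by apply: eq_bigr => k _; rewrite natrM !t0_tau.
Qed.
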